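(* For $n\ge 0$ let $A_n=\sum_{k=0}^n\binom{n}{k}^2\binom{n+k}{k}^2$. The sequence $\{A_n\}_{n=0}^\infty$ is strictly 2-log-convex.
   Context: A positive sequence $\{a_n\}_{n=0}^\infty$ is log-convex if $a_n^2\le a_{n-1}a_{n+1}$ for all $n\ge 1$. It is 2-log-convex if it is log-convex and for all $n\ge 1$, $$\left(a_na_{n+2}-a_{n+1}^2\right)^2\le\left(a_{n-1}a_{n+1}-a_n^2\right)\left(a_{n+1}a_{n+3}-a_{n+2}^2\right).$$ It is strictly 2-log-convex if it is 2-log-convex and the latter inequality is strict for all $n\ge 1$. *)

(* Defs.v *)
From mathcomp Require Import all_boot all_order all_algebra.
Set Implicit Arguments.
Unset Strict Implicit.
Unset Printing Implicit Defensive.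
Import Order.TTheory GRing.Theory Num.Theory.
Local Open Scope ring_scope.

(* Log-convexity is only defined for positive sequences, so positivity is
   part of the definition. *)
Definition log_convex (R : realDomainType) (a : nat -> R) : Prop :=
  (forall n : nat, 0 < a n) /\
  (forall n : nat, (1 <= n)%N -> a n ^+ 2 <= a n.-1 * a n.+1).

Definition two_log_convex (R : realDomainType) (a : nat -> R) : Prop :=
  log_convex a /\
  (forall n : nat, (1 <= n)%N ->
    (a n * a n.+2 - a n.+1 ^+ 2) ^+ 2 <=
    (a n.-1 * a n.+1 - a n ^+ 2) * (a n.+1 * a n.+3 - a n.+2 ^+ 2)).

Definition strictly_two_log_convex (R : realDomainType) (a : nat -> R) : Prop :=
  two_log_convex a /\
  (forall n : nat, (1 <= n)%N ->
    (a n * a n.+2 - a n.+1 ^+ 2) ^+ 2 <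
    (a n.-1 * a n.+1 - a n ^+ 2) * (a n.+1 * a n.+3 - a n.+2 ^+ 2)).

Definition apery (n : nat) : nat :=
  (\sum_(0 <= k < n.+1) 'C(n, k) ^ 2 * 'C(n + k, k) ^ 2)%N.

(* Main.v *)
Require Import Defs.
From mathcomp Require Import all_boot all_order all_algebra.
From mathcomp Require Import ring lra.
From mathcomp Require Import realalg.
Set Implicit Arguments.
Unset Strict Implicit.
Unset Printing Implicit Defensive.
Import Order.TTheory GRing.Theory Num.Theory.
Local Open Scope ring_scope.

(** Write A n for the Apery numbers, P n = 34 n^3 + 51 n^2 + 27 n + 5 and
    t n = A (n-1) A (n+1) / (A n)^2 - 1. Dividing by powers of the A's turns
    log-convexity into 0 <= t n, and the strict 2-log-convexity inequality
    around n into
      (t n)^2 < (1 + t n)^2 t (n-1) t (n+1).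
    Asymptotically t n is 3/(2 n^2), so the two sides agree to leading order;
    their logarithms differ by about 5/n^2. It is therefore enough to know
    n^2 t n with an error O(1/n^2) with a moderate constant.

    Such an estimate comes from Apery's recurrence (apery_rec), proved by
    creative telescoping. In terms of x n = n^3 A (n-1) / A n it reads
      x (n+1) (P n - x n) = (n+1)^6,
    a map that is increasing in x n and strongly contracting near its solution.
    Hence any two functions that satisfy the corresponding inequalities and
    enclose x 1 enclose x n for all n. Suitable functions are the truncated
    formal solution of this equation, which has coefficients in Q(sqrt 2), and
    the same plus 1/(20 n) (apery_ratio_bounds). Since
      (n (n+1))^3 (1 + t n) = x n (P n - x n),
    they give f n <= (n (n+1))^2 t n <= f n + 3 for an explicit quadratic f
    (log_defect_lower, log_defect_upper). With this window the inequality above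
    splits into two polynomial ones, because f n - 7/4 separates
    sqrt (f (n-1) f (n+1)) from the corresponding expression in t n
    (defect_approx_mul, defect_ratio_bound).

    The argument needs a square root of 2, so it is carried out in an ordered
    field containing one; as the inequalities are between integers, they then
    hold in every ordered domain (strictly_two_log_convex_nat). *)

(** * Apery's recurrence *)

Definition apery_root (n k : nat) : nat := ('C(n, k) * 'C(n + k, k))%N.

Lemma apery_root_small n k : (n < k)%N -> apery_root n k = 0%N.
Proof. by move=> ltnk; rewrite /apery_root bin_small. Qed.

Lemma aperyE (R : pzSemiRingType) (n m : nat) : (n < m)%N ->
  (apery n)%:R = \sum_(0 <= k < m) (apery_root n k)%:R ^+ 2 :> R.
Proof.
move=> ltnm; rewrite (big_cat_nat (n := n.+1)) //= [X in _ + X]big1_seq ?addr0.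
  by rewrite natr_sum; apply: eq_bigr => k _; rewrite -expnMn natrX.
move=> k /andP[_]; rewrite mem_index_iota => /andP[ltnk _].
by rewrite apery_root_small // expr0n.
Qed.

Lemma apery_root_up n k :
  ((n.+1 - k) * apery_root n.+1 k = (n.+1 + k) * apery_root n k)%N.
Proof.
apply/eqP; rewrite -(eqn_pmul2l (ltn0Sn n)); apply/eqP.
have e1 : ((n.+1 - k) * 'C(n.+1, k) = n.+1 * 'C(n, k))%N.
  by rewrite -mul_bin_down.
have e2 : (n.+1 * 'C(n.+1 + k, k) = (n.+1 + k) * 'C(n + k, k))%N.
  by rewrite [RHS]mul_bin_down addnK.
rewrite /apery_root.
transitivity (((n.+1 - k) * 'C(n.+1, k)) * (n.+1 * 'C(n.+1 + k, k)))%N.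
  by rewrite mulnCA -mulnA; congr (_ * _)%N; rewrite mulnCA.
by rewrite e1 e2; ring.
Qed.

Lemma apery_root_diag n k :
  (k.+1 ^ 2 * apery_root n.+1 k.+1
   = (n + k).+2 * (n + k).+1 * apery_root n k)%N.
Proof.
have e1 := mul_bin_diag n.+1 k.
have e2 := mul_bin_diag (n + k).+2 k.
have e3 : (n.+1 * 'C((n + k).+1, k) = (n + k).+1 * 'C(n + k, k))%N.
  by rewrite [RHS]mul_bin_down subSn ?leq_addl // addnK.
rewrite /apery_root addSn addnS.
move: e1 e2 e3; rewrite /=.
set a := 'C(n, k); set b := 'C(n.+1, k.+1); set c := 'C((n + k).+2, k.+1).
set d := 'C((n + k).+1, k); set e := 'C(n + k, k).
move=> e1 e2 e3.
have -> : (k.+1 ^ 2 * (b * c) = (k.+1 * b) * (k.+1 * c))%N by ring.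
rewrite -e1 -e2.
have -> : (n.+1 * a * ((n + k).+2 * d) = (n + k).+2 * a * (n.+1 * d))%N by ring.
rewrite e3; ring.
Qed.

Lemma apery_root_upr (R : pzRingType) n k :
  (n.+1%:R - k%:R) * (apery_root n.+1 k)%:R
  = (n.+1%:R + k%:R) * (apery_root n k)%:R :> R.
Proof.
have [lekn | ltnk] := leqP k n.+1.
  by rewrite -natrB // -natrD -!natrM apery_root_up.
by rewrite !apery_root_small ?mulr0 // ltnW.
Qed.

Lemma apery_root_diagr (R : pzRingType) n k :
  k.+1%:R ^+ 2 * (apery_root n.+1 k.+1)%:R
  = (n%:R + k%:R + 2) * (n%:R + k%:R + 1) * (apery_root n k)%:R :> R.
Proof.
have -> : n%:R + k%:R + 2 = (n + k).+2%:R :> R.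
  by rewrite -natrD -[2]/(2%:R) -natrD addn2.
have -> : n%:R + k%:R + 1 = (n + k).+1%:R :> R by rewrite -natrD natr1.
by rewrite -natrX -!natrM apery_root_diag.
Qed.

Definition apery_mid {R : pzSemiRingType} (n : R) : R :=
  34 * n ^+ 3 + 51 * n ^+ 2 + 27 * n + 5.

(** Zagier's telescoping certificate, as reported by van der Poorten. *)
Definition apery_cert (R : pzRingType) (n k : nat) : R :=
  4 * (2 * n%:R + 1) * (k%:R * (2 * k%:R + 1) - (2 * n%:R + 1) ^+ 2)
  * (apery_root n k)%:R ^+ 2.

(** All terms involved are c^2 times a polynomial in n and k, for the single
    quantity c = (n+k)! / (k!^2 (n+2-k)!), so that the identity becomes a
    polynomial one. Writing c as a quotient of the term for n+2, whose
    denominator never vanishes, covers the boundary values of k as well. *)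
Lemma apery_cert_step (F : numFieldType) n k :
  n.+2%:R ^+ 3 * (apery_root n.+2 k)%:R ^+ 2
  - apery_mid n.+1%:R * (apery_root n.+1 k)%:R ^+ 2
  + n.+1%:R ^+ 3 * (apery_root n k)%:R ^+ 2
  = apery_cert F n.+1 k - (if k is j.+1 then apery_cert F n.+1 j else 0).
Proof.
have nS : n.+1%:R = n%:R + 1 :> F by rewrite -natr1.
have nSS : n.+2%:R = n%:R + 2 :> F by rewrite -[n.+2]addn2 natrD.
case: k => [|k].
  have root0 m : apery_root m 0 = 1%N by rewrite /apery_root !bin0.
  by rewrite /apery_cert !root0 /apery_mid nSS nS; ring.
have nz1 : n%:R + 2 + k.+1%:R != 0 :> F.
  by rewrite -[2]/(2%:R) -!natrD pnatr_eq0 addn2.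
have nz2 : n%:R + 1 + k.+1%:R != 0 :> F.
  by rewrite -[1]/(1%:R) -!natrD pnatr_eq0 addn1.
pose c : F :=
  (apery_root n.+2 k.+1)%:R / ((n%:R + 2 + k.+1%:R) * (n%:R + 1 + k.+1%:R)).
have e2 : (apery_root n.+2 k.+1)%:R
  = (n%:R + 2 + k.+1%:R) * (n%:R + 1 + k.+1%:R) * c.
  by rewrite /c mulrC divfK // mulf_neq0.
have e1 : (apery_root n.+1 k.+1)%:R
  = (n%:R + 2 - k.+1%:R) * (n%:R + 1 + k.+1%:R) * c.
  apply: (mulfI nz1).
  by have := apery_root_upr F n.+1 k.+1; rewrite e2 nSS => <-; ring.
have e0 : (apery_root n k.+1)%:R
  = (n%:R + 2 - k.+1%:R) * (n%:R + 1 - k.+1%:R) * c.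
  apply: (mulfI nz2).
  by have := apery_root_upr F n k.+1; rewrite e1 nS => <-; ring.
have kS : k.+1%:R = k%:R + 1 :> F by rewrite -natr1.
have ed : (apery_root n.+1 k)%:R = (k%:R + 1) ^+ 2 * c.
  have nzd : (n.+1%:R + k%:R + 2) * (n.+1%:R + k%:R + 1) != 0 :> F.
    rewrite -[2]/(2%:R) -[1]/(1%:R) -!natrD.
    by rewrite mulf_neq0 // pnatr_eq0 ?addn1 ?addn2.
  apply: (mulfI nzd).
  by have := apery_root_diagr F n.+1 k; rewrite e2 kS nS => <-; ring.
rewrite /apery_cert ed e0 e1 e2 /apery_mid nSS nS kS; ring.
Qed.

Lemma apery_rec (F : numFieldType) n :
  n.+2%:R ^+ 3 * (apery n.+2)%:R - apery_mid n.+1%:R * (apery n.+1)%:R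
  + n.+1%:R ^+ 3 * (apery n)%:R = 0 :> F.
Proof.
rewrite (@aperyE _ n.+2 n.+3) // (@aperyE _ n.+1 n.+3) //.
rewrite (@aperyE _ n n.+3); last by rewrite ltnS ltnW.
rewrite !mulr_sumr -sumrB -big_split /=.
rewrite (eq_bigr _ (fun k _ => apery_cert_step F n k)).
pose cert k := if k is j.+1 then apery_cert F n.+1 j else 0.
rewrite (@telescope_sumr_eq _ 0 n.+3 cert) //.
by rewrite subr0 /cert /apery_cert apery_root_small // expr0n mulr0.
Qed.

(** * The recurrence for consecutive ratios *)

Lemma apery_gt0 n : (0 < apery n)%N.
Proof. by rewrite /apery big_nat_recl // !bin0. Qed.

(** The factor n^3 clears the denominators of the recurrence and makes the ratio
    asymptotically polynomial in n. *)
Definition apery_ratio (F : fieldType) (n : nat) : F :=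
  n%:R ^+ 3 * (apery n.-1)%:R / (apery n)%:R.

Section Ratio.
Variable F : realFieldType.
Local Notation a n := ((apery n)%:R : F).
Local Notation x := (apery_ratio F).

Lemma aperyS_ratio n : n.+1%:R ^+ 3 * a n.+1 = a n * (apery_mid n%:R - x n).
Proof.
have an0 : a n != 0 by rewrite pnatr_eq0 -lt0n apery_gt0.
rewrite mulrBr /x mulrCA divff // mulr1.
case: n an0 => [|n] an0 /=; last by have := apery_rec F n; lra.
have -> : apery 1 = 5%N by rewrite /apery unlock.
have -> : apery 0 = 1%N by rewrite /apery unlock.
by rewrite /apery_mid; ring.
Qed.

Lemma apery_ratio_step n : x n.+1 * (apery_mid n%:R - x n) = n.+1%:R ^+ 6.
Proof.
have an0 : a n != 0 by rewrite pnatr_eq0 -lt0n apery_gt0.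
have an1 : a n.+1 != 0 by rewrite pnatr_eq0 -lt0n apery_gt0.
have -> : apery_mid n%:R - x n = n.+1%:R ^+ 3 * a n.+1 / a n.
  by rewrite aperyS_ratio mulrC mulKf.
by rewrite /apery_ratio /=; field; rewrite an0 an1.
Qed.

End Ratio.

(** * The asymptotic approximations *)

(** With s = sqrt 2, these are the terms of nonnegative degree in the formal
    series in n that solves x (n+1) (P n - x n) = (n+1)^6 and has the smaller
    root 17 - 12 s of b (34 - b) = 1 as leading coefficient. *)
Definition ratio_approx {F : realFieldType} (s n : F) : F :=
  (17 - 12 * s) * (n ^+ 3 + 3 / 2 * n ^+ 2) + (27 / 2 - 609 / 64 * s) * n
  + (645 / 256 - 225 / 128 * s).

(** The leading part of x (P - x) / (n (n+1)) - (n (n+1))^2 for the above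
    series. The substitution of -1-n for n amounts to changing the sign of s,
    which accounts for the shape in terms of n (n+1) and s (2 n+1). *)
Definition defect_approx {F : realFieldType} (s n : F) : F :=
  3 / 2 * (n * (n + 1)) + 15 / 64 * s * (2 * n + 1).

(** Consecutive convergents of the continued fraction of sqrt 2. Such accuracy
    is needed since the upper approximation exceeds x 1 = 1/5 by less than
    1/10000. *)
Lemma sqrt2_bounds (F : realFieldType) (s : F) : 0 < s -> s ^+ 2 = 2 ->
  (1393 / 985 < s) * (s < 3363 / 2378).
Proof. by move=> s0 s2; split; nra. Qed.

Section Approx.
Variable F : realFieldType.
Implicit Types s n : F.

(** As the approximation is exact up to O(1/n), all terms of degree 3 to 6
    cancel, and the sign of the remainder can be read off. *)
Lemma ratio_approx_step s n : s ^+ 2 = 2 ->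
  (n + 1) ^+ 6 - ratio_approx s (n + 1) * (apery_mid n - ratio_approx s n)
  = 27 / 32 * (59 / 64) * n ^+ 2
    + (27 / 32 * (59 / 32) - 45 / 64 * (89 / 128) * s) * n
    + ((249 / 256) ^+ 2 - 45 / 64 * (89 / 128) * s).
Proof. by move=> s2; rewrite /ratio_approx /apery_mid; field: s2. Qed.

Lemma ratio_approx_defect s n : s ^+ 2 = 2 ->
  ratio_approx s n * (apery_mid n - ratio_approx s n) - (n * (n + 1)) ^+ 3
  - n * (n + 1) * defect_approx s n
  = 27 / 32 * (45 / 64) * n ^+ 2
    + (27 / 32 * (45 / 64) + 45 / 64 * (25 / 128) * s) * n
    + (75 / 256 * (61 / 256) + 45 / 128 * (25 / 128) * s).
Proof.
by move=> s2; rewrite /ratio_approx /defect_approx /apery_mid; field: s2.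
Qed.

Lemma ratio_approx_lower_step s n : 0 < s -> s ^+ 2 = 2 -> 0 <= n ->
  ratio_approx s (n + 1) * (apery_mid n - ratio_approx s n) <= (n + 1) ^+ 6.
Proof.
move=> s0 s2 n0; rewrite -subr_ge0 ratio_approx_step //.
have [_ s_hi] := sqrt2_bounds s0 s2.
have nn := sqr_ge0 n.
have s_hi' : s < 17 / 12 by lra.
have : 0 <= n * (17 / 12 - s) by rewrite mulr_ge0 // subr_ge0 ltW.
move: s_hi' nn n0; clear; lra.
Qed.

(** The added term 1/(20 n) exceeds the next term of the formal series, which is
    about 0.023/n; therefore it reverses the sign of the remainder in
    ratio_approx_step. *)
Lemma ratio_approx_upper_step s n : 0 < s -> s ^+ 2 = 2 -> 1 <= n ->
  (n + 1) ^+ 6 <= (ratio_approx s (n + 1) + (20 * (n + 1))^-1)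
                  * (apery_mid n - (ratio_approx s n + (20 * n)^-1)).
Proof.
move=> s0 s2 n1; have [s_lo s_hi] := sqrt2_bounds s0 s2.
have n0 : 0 < n by lra.
have n10 : 0 < n + 1 by lra.
rewrite -subr_ge0.
have -> : (ratio_approx s (n + 1) + (20 * (n + 1))^-1)
     * (apery_mid n - (ratio_approx s n + (20 * n)^-1)) - (n + 1) ^+ 6
  = (20 * n * (apery_mid n - ratio_approx s n)
     - 20 * (n + 1) * ratio_approx s (n + 1) - 1
     - 20 * n * (20 * (n + 1)) * ((n + 1) ^+ 6 -
         ratio_approx s (n + 1) * (apery_mid n - ratio_approx s n)))
    / (20 * n * (20 * (n + 1))).
  by field; rewrite !lt0r_neq0.
have den0 : 0 <= 20 * n * (20 * (n + 1)).
  by rewrite !mulr_ge0 // ltW.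
apply: divr_ge0 => //.
rewrite ratio_approx_step // /ratio_approx /apery_mid.
(* The numerator is a polynomial in m = n - 1 whose coefficients are positive and
   affine in s; the products below let linear arithmetic see this. *)
have [m m0 ->] : exists2 m, 0 <= m & n = m + 1 by exists (n - 1); lra.
have lo : 0 <= s - 41 / 29 by move: s_lo; clear; lra.
have hi : 0 <= 17 / 12 - s by move: s_hi; clear; lra.
clear s_lo s_hi.
have m2 := exprn_ge0 2 m0.
have m3 := exprn_ge0 3 m0.
have m4 := exprn_ge0 4 m0.
have := mulr_ge0 m0 lo; have := mulr_ge0 m0 hi.
have := mulr_ge0 m2 lo; have := mulr_ge0 m2 hi.
have := mulr_ge0 m3 lo; have := mulr_ge0 m3 hi.
have := mulr_ge0 m4 lo; have := mulr_ge0 m4 hi.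
lra.
Qed.

Lemma ratio_approx_ge0 s n : 0 < s -> s ^+ 2 = 2 -> 0 <= n ->
  0 <= ratio_approx s n.
Proof.
move=> s0 s2 n0; have [_ s_hi] := sqrt2_bounds s0 s2.
have n2 := exprn_ge0 2 n0; have n3 := exprn_ge0 3 n0.
have c3 : 0 <= 17 - 12 * s by move: s_hi; clear; lra.
have c1 : 0 <= 27 / 2 - 609 / 64 * s by move: s_hi; clear; lra.
have c0 : 0 <= 645 / 256 - 225 / 128 * s by move: s_hi; clear; lra.
have cubic : 0 <= n ^+ 3 + 3 / 2 * n ^+ 2 by move: n2 n3; clear; lra.
apply: addr_ge0 => //; apply: addr_ge0; exact: mulr_ge0.
Qed.

Lemma ratio_approx_le_mid s n : 0 < s -> s ^+ 2 = 2 -> 1 <= n ->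
  2 * (ratio_approx s n + (20 * n)^-1) <= apery_mid n.
Proof.
move=> s0 s2 n1; have [s_lo _] := sqrt2_bounds s0 s2.
have n0 : 0 <= n by lra.
have : (20 * n)^-1 <= 1 by rewrite invf_le1; lra.
rewrite /ratio_approx /apery_mid.
have lo : 0 <= s - 41 / 29 by move: s_lo; clear; lra.
clear s_lo.
have n2 := exprn_ge0 2 n0; have n3 := exprn_ge0 3 n0.
have := mulr_ge0 n0 lo; have := mulr_ge0 n2 lo; have := mulr_ge0 n3 lo.
lra.
Qed.

(** Adding 1/(20 n) to x moves x (P - x) / (n (n+1)) by about
    (34 - 2 (17 - 12 s))/20, that is 1.7, and by ratio_approx_defect the error
    of defect_approx is below 1, whence the constant 3. *)
Lemma ratio_approx_upper_defect s n : 0 < s -> s ^+ 2 = 2 -> 2 <= n ->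
  (ratio_approx s n + (20 * n)^-1)
    * (apery_mid n - (ratio_approx s n + (20 * n)^-1))
  <= (n * (n + 1)) ^+ 3 + n * (n + 1) * (defect_approx s n + 3).
Proof.
move=> s0 s2 n2; have [s_lo s_hi] := sqrt2_bounds s0 s2.
have n0 : 0 < n by lra.
have e2 := sqr_ge0 (20 * n)^-1.
suff : 20 * n * (ratio_approx s n * (apery_mid n - ratio_approx s n)
     - (n * (n + 1)) ^+ 3 - n * (n + 1) * defect_approx s n)
     + (apery_mid n - 2 * ratio_approx s n) <= 20 * n * (3 * (n * (n + 1))).
  rewrite -(ler_pM2l (_ : 0 < (20 * n)^-1)) ?invr_gt0 ?mulr_gt0 //.
  rewrite mulrDr !mulKf ?mulf_neq0 ?gt_eqF //.
  move: e2; set e := (20 * n)^-1; set r := ratio_approx s n.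
  clear; lra.
rewrite ratio_approx_defect // /ratio_approx /apery_mid.
(* The right-hand side minus the left-hand side is a polynomial in m = n - 2 whose
   coefficients are positive and affine in s. *)
have [m m0 ->] : exists2 m, 0 <= m & n = m + 2 by exists (n - 2); lra.
have lo : 0 <= s - 41 / 29 by move: s_lo; clear; lra.
have hi : 0 <= 17 / 12 - s by move: s_hi; clear; lra.
clear s_lo s_hi.
have m2 := exprn_ge0 2 m0; have m3 := exprn_ge0 3 m0.
have := mulr_ge0 m0 lo; have := mulr_ge0 m0 hi.
have := mulr_ge0 m2 lo; have := mulr_ge0 m2 hi.
have := mulr_ge0 m3 lo; have := mulr_ge0 m3 hi.
lra.
Qed.

End Approx.

(** * Bounds for the Apery numbers *)

Lemma le_parabola (F : realFieldType) (p y z : F) : y <= z -> 2 * z <= p ->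
  y * (p - y) <= z * (p - z).
Proof. by move=> yz zp; nra. Qed.

Section Bounds.
Variable F : realFieldType.
Implicit Type s : F.
Local Notation x := (apery_ratio F).
Local Notation lower s n := (ratio_approx s n%:R).
Local Notation upper s n := (ratio_approx s n%:R + (20 * n%:R)^-1).

(** Induction: x (n+1) = (n+1)^6 / (P n - x n) is an increasing function of x n
    as long as x n < P n. *)
Lemma apery_ratio_bounds s n : 0 < s -> s ^+ 2 = 2 ->
  (lower s n.+1 <= x n.+1) * (x n.+1 <= upper s n.+1).
Proof.
move=> s0 s2; elim: n => [|n [IHlo IHhi]].
  have -> : x 1%N = 5^-1.
    have -> : x 1%N = 1 ^+ 3 * (apery 0)%:R / (apery 1)%:R by [].
    have -> : apery 1 = 5%N by rewrite /apery unlock.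
    have -> : apery 0 = 1%N by rewrite /apery unlock.
    by rewrite expr1n !mul1r.
  have [s_lo s_hi] := sqrt2_bounds s0 s2.
  by rewrite /ratio_approx; split; move: s_lo s_hi; clear; lra.
have n1 : 1 <= n.+1%:R :> F by rewrite ler1n.
have n0 := le_trans ler01 n1.
have nS : n.+2%:R = n.+1%:R + 1 :> F by rewrite natr1.
have mid_gt : 0 < apery_mid n.+1%:R - x n.+1.
  rewrite subr_gt0 (le_lt_trans IHhi) //.
  have := ratio_approx_le_mid s0 s2 n1.
  have := ratio_approx_ge0 s0 s2 n0.
  have : 0 < (20 * n.+1%:R)^-1 :> F by rewrite invr_gt0 mulr_gt0 // ltr0Sn.
  move: (_^-1) (lower s n.+1) (apery_mid _) => e r t; clear; lra.
have low0 : 0 <= lower s n.+2 by rewrite ratio_approx_ge0.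
have up0 : 0 <= upper s n.+2 by rewrite addr_ge0 // invr_ge0 mulr_ge0.
have step := apery_ratio_step F n.+1.
split; rewrite -(ler_pM2r mid_gt) step nS.
  apply: le_trans (ratio_approx_lower_step s0 s2 n0).
  by rewrite ler_wpM2l -?nS // lerB.
apply: le_trans (ratio_approx_upper_step s0 s2 n1) _.
by rewrite ler_wpM2l -?nS // lerB.
Qed.

(** Nonnegativity of this quantity is log-convexity at n. *)
Definition log_defect (n : nat) : F :=
  (apery n.-1)%:R * (apery n.+1)%:R / (apery n)%:R ^+ 2 - 1.

Local Notation z n := (n%:R * (n%:R + 1) : F).

Lemma log_defectE n :
  z n ^+ 3 * (1 + log_defect n) = x n * (apery_mid n%:R - x n).
Proof.
have an0 : (apery n)%:R != 0 :> F by rewrite pnatr_eq0 -lt0n apery_gt0.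
have -> : apery_mid n%:R - x n
    = (n%:R + 1) ^+ 3 * (apery n.+1)%:R / (apery n)%:R.
  by rewrite natr1 aperyS_ratio mulrC mulKf.
by rewrite /log_defect /apery_ratio; field; rewrite an0.
Qed.

Lemma log_defect_lower s n : 0 < s -> s ^+ 2 = 2 -> (0 < n)%N ->
  defect_approx s n%:R <= z n ^+ 2 * log_defect n.
Proof.
case: n => [|n] s0 s2 n_gt0 //.
have [lo hi] := apery_ratio_bounds n s0 s2.
have n1 : 1 <= n.+1%:R :> F by rewrite ler1n.
have n0 := le_trans ler01 n1.
have mid := ratio_approx_le_mid s0 s2 n1.
have z0 : 0 < z n.+1 by rewrite mulr_gt0 ?natr1.
rewrite -(ler_pM2l z0).
have := log_defectE n.+1.
have := ratio_approx_defect n.+1%:R s2.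
have nn := exprn_ge0 2 n0; have ns := mulr_ge0 n0 (ltW s0).
have xle : 2 * x n.+1 <= apery_mid n.+1%:R.
  by apply: le_trans mid; rewrite ler_pM2l.
have := le_parabola lo xle.
move: (log_defect n.+1) (defect_approx s n.+1%:R) s0 n0 nn ns.
move: (x n.+1) (lower s n.+1).
move: (n.+1%:R) => t X L d f s0' t0 tt ts; clear -s0' t0 tt ts.
lra.
Qed.

Lemma log_defect_upper s n : 0 < s -> s ^+ 2 = 2 -> (1 < n)%N ->
  z n ^+ 2 * log_defect n <= defect_approx s n%:R + 3.
Proof.
case: n => [|n] s0 s2 n_gt1 //.
have [lo hi] := apery_ratio_bounds n s0 s2.
have n2 : 2 <= n.+1%:R :> F by rewrite ler_nat.
have n1 : 1 <= n.+1%:R :> F by rewrite ler1n.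
have z0 : 0 < z n.+1 by rewrite mulr_gt0 ?natr1.
rewrite -(ler_pM2l z0).
have mid := ratio_approx_le_mid s0 s2 n1.
have := log_defectE n.+1.
have := ratio_approx_upper_defect s0 s2 n2.
have := le_parabola hi mid.
move: (log_defect n.+1) (defect_approx s n.+1%:R).
move: (x n.+1) (upper s n.+1) (n.+1%:R) => X U t d f; clear.
lra.
Qed.
End Bounds.

(** * Strict 2-log-convexity *)

Section TwoLogConvexity.
Variable F : realFieldType.
Implicit Type s : F.

(** For large n, sqrt (f (n-1) f (n+1)) is close to f n - 3/2. *)
Lemma defect_approx_mul s (n : F) : 0 < s -> s ^+ 2 = 2 -> 2 <= n ->
  (defect_approx s n - 7 / 4) ^+ 2
  < defect_approx s (n - 1) * defect_approx s (n + 1).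
Proof.
move=> s0 s2 n2; rewrite -subr_gt0.
have -> : defect_approx s (n - 1) * defect_approx s (n + 1)
    - (defect_approx s n - 7 / 4) ^+ 2
  = 3 / 4 * (n * (n + 1) - 6) + 15 / 128 * s * (2 * n + 1)
    + (9 / 4 - 13 / 16 - 2 * (15 / 32) ^+ 2).
  by rewrite /defect_approx; field: s2.
have : 0 <= (n - 2) * (n + 3) by apply: mulr_ge0; lra.
have : 0 <= s * (2 * n + 1) by apply: mulr_ge0; lra.
lra.
Qed.

(** To be used with z = n (n+1) and f = defect_approx s n. The claim is affine
    in z^2 t, so it needs to be checked only at the ends f and f + 3 of the
    interval; at the upper one, which is the critical one, the left-hand side
    divided by 1 + t is close to f - 9/4 (as f is close to 3/2 z). *)
Lemma defect_ratio_bound (z f t : F) : 6 <= z -> 3 / 2 * z <= f ->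
  f <= z ^+ 2 * t -> z ^+ 2 * t <= f + 3 ->
  z * (z - 2) * t <= (1 + t) * (f - 7 / 4).
Proof.
move=> z6 zf lo hi.
have z2 : 0 < z ^+ 2 by rewrite exprn_gt0; lra.
rewrite -(ler_pM2l z2).
have -> : z ^+ 2 * (z * (z - 2) * t) = z * (z - 2) * (z ^+ 2 * t) by ring.
have -> : z ^+ 2 * ((1 + t) * (f - 7 / 4))
  = (z ^+ 2 + z ^+ 2 * t) * (f - 7 / 4) by ring.
move: lo hi; move: (z ^+ 2 * t) => u lo hi.
have lo0 : 0 <= u - f by lra.
have hi0 : 0 <= f + 3 - u by lra.
(* The claim at z ^+ 2 * t = f and at z ^+ 2 * t = f + 3. *)
have end_lo : 0 <= f ^+ 2 + 2 * z * f - 7 / 4 * z ^+ 2 - 7 / 4 * f by nra.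
have end_hi : 0 <= f ^+ 2 + 2 * z * f + 5 / 4 * f + 6 * z - 21 / 4
                   - 19 / 4 * z ^+ 2 by nra.
have := mulr_ge0 hi0 end_lo; have := mulr_ge0 lo0 end_hi.
clear; lra.
Qed.

Lemma log_defect_gt0 s n : 0 < s -> s ^+ 2 = 2 -> (0 < n)%N ->
  0 < log_defect F n.
Proof.
move=> s0 s2 n0.
have := log_defect_lower s0 s2 n0.
have z0 : 0 < n%:R * (n%:R + 1) :> F by rewrite natr1 mulr_gt0 ?ltr0n.
move=> le; rewrite -(pmulr_rgt0 _ (exprn_gt0 2 z0)); apply: lt_le_trans le.
rewrite /defect_approx.
have : 0 < s * (2 * n%:R + 1) by rewrite mulr_gt0 // ltr_wpDl // mulr_ge0.
move: z0; clear; lra.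
Qed.

Lemma log_defect_square_lt s n : 0 < s -> s ^+ 2 = 2 -> (1 < n)%N ->
  log_defect F n ^+ 2
  < (1 + log_defect F n) ^+ 2 * (log_defect F n.-1 * log_defect F n.+1).
Proof.
move=> s0 s2 n_gt1.
have n_gt0 := ltnW n_gt1.
have np_gt0 : (0 < n.-1)%N by rewrite -subn1 subn_gt0.
have lo_p := log_defect_lower s0 s2 np_gt0.
have lo_n := log_defect_lower s0 s2 (ltn0Sn n).
have lo := log_defect_lower s0 s2 n_gt0.
have hi := log_defect_upper s0 s2 n_gt1.
have t0 := log_defect_gt0 s0 s2 n_gt0.
have predE : n.-1%:R = n%:R - 1 :> F by rewrite -subn1 natrB.
have n2 : 2 <= n%:R :> F by rewrite ler_nat.
have := defect_approx_mul s0 s2 n2.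
move: lo_p lo_n lo hi t0; rewrite predE -natr1.
move: (log_defect F n) (log_defect F n.-1) (log_defect F n.+1).
move: (n%:R : F) n2 => k k2 t tp tn lo_p lo_n lo hi t0 prod_lt.
have k0 : 0 <= (k - 2) * (k + 3) by apply: mulr_ge0; lra.
have z6 : 6 <= k * (k + 1) by move: k0; clear; lra.
have sk : 0 <= s * (2 * k + 1) by apply: mulr_ge0; lra.
have zf : 3 / 2 * (k * (k + 1)) <= defect_approx s k.
  by rewrite /defect_approx; move: sk; clear; lra.
have bnd := defect_ratio_bound z6 zf lo hi.
have f_p : 0 <= defect_approx s (k - 1).
  have : 0 <= (k - 1) * k by apply: mulr_ge0; lra.
  have : 0 <= s * (2 * k - 1) by apply: mulr_ge0; lra.
  by rewrite /defect_approx; clear; lra.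
have f_n : 0 <= defect_approx s (k + 1).
  have : 0 <= (k + 1) * (k + 2) by apply: mulr_ge0; lra.
  have : 0 <= s * (2 * k + 3) by apply: mulr_ge0; lra.
  by rewrite /defect_approx; clear; lra.
(* n (n+1) (n (n+1) - 2) is the product of the factors (n-1) n and (n+1) (n+2)
   that scale the defects at n - 1 and n + 1. *)
set w := k * (k + 1) * (k * (k + 1) - 2) in bnd.
have w0 : 0 < w by apply: mulr_gt0; lra.
have wE : w ^+ 2 * (tp * tn)
    = ((k - 1) * (k - 1 + 1)) ^+ 2 * tp * (((k + 1) * (k + 1 + 1)) ^+ 2 * tn).
  by rewrite /w; ring.
have prod_le := ler_pM f_p f_n lo_p lo_n; rewrite -wE in prod_le.
have {prod_lt prod_le}lt_w := lt_le_trans prod_lt prod_le.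
rewrite -(ltr_pM2l (exprn_gt0 2 w0)).
rewrite -exprMn mulrCA.
apply: (@le_lt_trans _ _ (((1 + t) * (defect_approx s k - 7 / 4)) ^+ 2)).
  by rewrite lerXn2r // nnegrE ?(le_trans _ bnd) // mulr_ge0 // ltW.
by rewrite exprMn ltr_pM2l // exprn_gt0 // addr_gt0.
Qed.

Lemma log_defect_num n : (apery n.-1)%:R * (apery n.+1)%:R - (apery n)%:R ^+ 2
  = (apery n)%:R ^+ 2 * log_defect F n.
Proof.
have an0 : (apery n)%:R != 0 :> F by rewrite pnatr_eq0 -lt0n apery_gt0.
by rewrite /log_defect; field; rewrite an0.
Qed.

Lemma apery_strictly_two_log_convex s : 0 < s -> s ^+ 2 = 2 ->
  strictly_two_log_convex (fun n => (apery n)%:R : F).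
Proof.
move=> s0 s2.
have a0 n : 0 < (apery n)%:R :> F by rewrite ltr0n apery_gt0.
have two_lt n : (1 <= n)%N ->
  ((apery n)%:R * (apery n.+2)%:R - (apery n.+1)%:R ^+ 2) ^+ 2 <
  ((apery n.-1)%:R * (apery n.+1)%:R - (apery n)%:R ^+ 2)
  * ((apery n.+1)%:R * (apery n.+3)%:R - (apery n.+2)%:R ^+ 2) :> F.
  move=> n1.
  rewrite (log_defect_num n.+1) (log_defect_num n) (log_defect_num n.+2).
  have lt := @log_defect_square_lt s n.+1 s0 s2 n1.
  have e : (apery n)%:R * (apery n.+2)%:R
      = (apery n.+1)%:R ^+ 2 * (1 + log_defect F n.+1).
    by have := log_defect_num n.+1; rewrite /=; lra.
  have -> : (apery n)%:R ^+ 2 * log_defect F n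
      * ((apery n.+2)%:R ^+ 2 * log_defect F n.+2)
    = ((apery n)%:R * (apery n.+2)%:R) ^+ 2
      * (log_defect F n * log_defect F n.+2) by ring.
  move: lt; rewrite e -(ltr_pM2l (exprn_gt0 2 (exprn_gt0 2 (a0 n.+1)))).
  by rewrite -exprMn [X in _ < X -> _]mulrA -[X in _ < X * _ -> _]exprMn.
split; last exact: two_lt.
split; last by move=> n /two_lt/ltW.
split=> // n n1; rewrite -subr_ge0 log_defect_num mulr_ge0 ?exprn_ge0 ?ltW //.
exact: log_defect_gt0 s0 s2 n1.
Qed.

End TwoLogConvexity.

(** Both statements are images of the one over the integers, which embed in
    every ordered domain with their order. *)
Lemma strictly_two_log_convex_nat (R S : realDomainType) (a : nat -> nat) :
  strictly_two_log_convex (fun n => (a n)%:R : R) ->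
  strictly_two_log_convex (fun n => (a n)%:R : S).
Proof.
have toint (T : realDomainType) :
   strictly_two_log_convex (fun n => (a n)%:R : T) <->
   strictly_two_log_convex (fun n => (a n)%:Z).
  have castE := (rmorphXn, rmorphM, rmorphB, rmorph0, =^~ pmulrn).
  split=> -[[[pos lc] tlc] stlc]; ((split; first split; first split) => n;
    [move: (pos n) | move/lc | move/tlc | move/stlc];
    by rewrite -?(ler_int T) -?(ltr_int T) !castE).
by move=> /toint/toint.
Qed.

Theorem theorem5p1 (R : realDomainType) :
  strictly_two_log_convex (fun n : nat => (apery n)%:R : R).
Proof.
apply: (@strictly_two_log_convex_nat realalg).
apply: (@apery_strictly_two_log_convex _ (Num.sqrt 2)).
  by rewrite sqrtr_gt0.
by rewrite sqr_sqrtr.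
Qed.
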